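(* Let $n$ be a positive integer, and suppose that the coordinates of $\mathbf a\in\mathbb Z^n$ are positive integers, that $k,\ell$ are natural numbers with $\ell\leq n/2$, and that $S(\mathbf a,k)$ does not shatter any $\ell$-element subset of $[n]$. Then $$|S(\mathbf a,k)|\leq\binom{n}{\ell-1}.$$
   Context: Natural numbers include $0$, $[n]=\{1,\ldots,n\}$, and $\binom{n}{-1}=0$. For $\mathbf a=(a_1,\ldots,a_n)$ with positive integer components and a natural number $k$, put $$S(\mathbf a,k)=\Big\{(v_1,\ldots,v_n)\in\{0,1\}^n:\ \sum_{i=1}^n a_iv_i=k\Big\}.$$ The set $S(\mathbf a,k)$ is identified with the set family $\mathcal F\subseteq 2^{[n]}$ consisting of those $F\subseteq[n]$ whose characteristic vector lies in $S(\mathbf a,k)$, i.e. those $F$ with $\sum_{i\in F}a_i=k$. A set family $\mathcal F\subseteq 2^{[n]}$ shatters a subset $S\subseteq[n]$ if for every $Y\subseteq S$ there exists $F\in\mathcal F$ such that $F\cap S=Y$. *)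

(* Defs.v *)
From mathcomp Require Import all_boot all_order all_algebra.

Set Implicit Arguments.
Unset Strict Implicit.
Unset Printing Implicit Defensive.

Import Order.TTheory GRing.Theory Num.Theory.

Local Open Scope ring_scope.

(* The ground set [n] = {1, ..., n} is represented by 'I_n = {0, ..., n-1},
   and {0,1}^n by {ffun 'I_n -> bool}; below, v i is coerced to 0 or 1. *)
Definition subset_sum_vectors n (a : 'rV[int]_n) (k : nat)
    : {set {ffun 'I_n -> bool}} :=
  [set v : {ffun 'I_n -> bool} | \sum_(i < n) a 0 i * (v i)%:R == k%:Z].

Definition char_vector n (F : {set 'I_n}) : {ffun 'I_n -> bool} :=
  [ffun i => i \in F].

Definition family_of_vectors n (V : {set {ffun 'I_n -> bool}})
    : {set {set 'I_n}} :=
  [set F : {set 'I_n} | char_vector F \in V].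

Definition shatters (T : finType) (Fam : {set {set T}}) (S : {set T}) : Prop :=
  forall Y : {set T}, Y \subset S -> exists2 F, F \in Fam & F :&: S = Y.

(* Unlike 'C(n, l.-1), which would give 'C(n, 0) = 1 at l = 0, this is 0 at a
   negative lower index. *)
Definition binomial_int (n : nat) (m : int) : nat :=
  if m is Posz j then 'C(n, j) else 0%N.

(* Main.v *)
Require Import Defs.
From mathcomp Require Import all_boot all_order all_algebra zify.

(** The claim is linear algebra on square-free polynomials.  A set [s] stands
    for the monomial [x_s], the product of the [x_i] with [i] in [s]; on the
    cube, [x_s] takes at [F] the value 1 if [s \subset F] and 0 otherwise.  If
    [l = 0], the empty set is not shattered, so the family is empty.  Otherwise,
    put [d = l - 1], and let [P_e] be the space of square-free polynomials of
    degree at most [e], of dimension ['C(n, 0) + ... + 'C(n, e)].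

    First, [P_d] spans all functions on the family.  If a set [S] is not
    shattered, some [Y \subset S] is the trace on [S] of no member, and the
    polynomial that indicates trace [Y] on [S] vanishes on the family; its
    leading monomial is [x_S], which is therefore a combination of smaller
    monomials.  Since no set of size [d + 1] is shattered, neither is any larger
    one, and all the monomials of degree above [d] can be eliminated.  The
    elimination is carried out in dual form, in [trace_sums_eq0]: it shows that
    a weighting of the members that is orthogonal to [P_d] is zero.

    Second, many elements of [P_d] vanish on the family, namely the multiples
    of [f = \sum_i w_i x_i - k] by the elements of [P_(d-1)].  Multiplication by
    [f] is injective on [P_(d-1)]: the leading form of [f p] is the square-free
    part of [\sum_i w_i x_i] times the leading form of [p].  Once each variable
    is rescaled by its (nonzero) weight, this becomes the operator [up] of the
    Boolean lattice, which is injective below the middle level because of the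
    commutation relation [down_up] between [up] and its adjoint [down].

    Hence the family has at most
    [\dim P_d - \dim P_(d-1) = 'C(n, d)] elements; the rank count is
    [card_exact_le]. *)

Import Order.TTheory GRing.Theory Num.Theory.

Local Open Scope ring_scope.

(** * Ranks *)

Lemma enum_val_extend (V : zmodType) (T : finType) (A : {set T})
    (x : 'I_#|A| -> V) :
  exists c : T -> V, forall i, c (enum_val i) = x i.
Proof.
exists (fun s => \sum_(i | enum_val i == s) x i) => i.
by rewrite (big_pred1 i) // => j; rewrite (inj_eq enum_val_inj).
Qed.

(** Read [N] and [M] as the matrices of a complex [K^A -> K^B -> K^C] whose
    first map is injective and whose second one is surjective, the latter being
    stated as the injectivity of the transpose. *)
Lemma card_exact_le (K : fieldType) (T1 T2 T3 : finType)
    (A : {set T1}) (B : {set T2}) (C : {set T3})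
    (N : T1 -> T2 -> K) (M : T2 -> T3 -> K) :
    (forall c : T1 -> K,
       (forall t, t \in B -> \sum_(s in A) c s * N s t = 0) ->
       forall s, s \in A -> c s = 0) ->
    (forall g : T3 -> K,
       (forall t, t \in B -> \sum_(v in C) M t v * g v = 0) ->
       forall v, v \in C -> g v = 0) ->
    (forall s v, s \in A -> v \in C -> \sum_(t in B) N s t * M t v = 0) ->
  (#|A| + #|C| <= #|B|)%N.
Proof.
move=> injN surjM NM0.
pose Nx := \matrix_(i < #|A|, j < #|B|) N (enum_val i) (enum_val j).
pose Mx := \matrix_(i < #|B|, j < #|C|) M (enum_val i) (enum_val j).
have /eqP <- : row_free Nx.
  apply: inj_row_free => x xN0; have [c cE] := enum_val_extend _ _ _ (x 0).
  apply/rowP => i; rewrite mxE -cE; apply: injN (enum_valP i) => t tB.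
  have /rowP/(_ (enum_rank_in tB t)) := xN0; rewrite !mxE => eq0.
  rewrite -[RHS]eq0 [LHS]big_enum_val.
  by apply: eq_bigr => j _; rewrite mxE enum_rankK_in // cE.
have /eqP <- : row_free Mx^T.
  apply: inj_row_free => x xM0; have [g gE] := enum_val_extend _ _ _ (x 0).
  apply/rowP => i; rewrite mxE -gE; apply: surjM (enum_valP i) => t tB.
  have /rowP/(_ (enum_rank_in tB t)) := xM0; rewrite !mxE => eq0.
  rewrite -[RHS]eq0 [LHS]big_enum_val.
  by apply: eq_bigr => j _; rewrite !mxE enum_rankK_in // gE mulrC.
rewrite mxrank_tr; apply: mulmx0_rank_max; apply/matrixP => i j; rewrite !mxE.
rewrite -[RHS](NM0 _ _ (enum_valP i) (enum_valP j)) [RHS]big_enum_val.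
by apply: eq_bigr => m _; rewrite !mxE.
Qed.

(** * The Boolean lattice *)

Section BooleanLattice.

Variables (R : realFieldType) (T : finType).
Implicit Types (f g : {set T} -> R) (s t : {set T}).

Definition up f t := \sum_(i in t) f (t :\ i).
Definition down f s := \sum_(i in ~: s) f (i |: s).

Lemma up_adjoint f g : \sum_s f s * down g s = \sum_t up f t * g t.
Proof.
transitivity (\sum_i \sum_(s : {set T} | i \in ~: s) f s * g (i |: s)).
  rewrite (exchange_big_dep xpredT) //=; apply: eq_bigr => s _.
  by rewrite mulr_sumr.
transitivity (\sum_i \sum_(t : {set T} | i \in t) f (t :\ i) * g t); last first.
  rewrite (exchange_big_dep xpredT) //=; apply: eq_bigr => t _.
  by rewrite mulr_suml.
apply: eq_bigr => i _.
rewrite (reindex_onto (fun t => t :\ i) (fun s => i |: s)) /=; last first.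
  by move=> s; rewrite inE; apply: setU1K.
apply: eq_big => [t | t /andP[_ /eqP->] //].
rewrite inE setD11 /=; apply/eqP/idP => [<- | it]; first exact: setU11.
exact: setD1K.
Qed.

(** Going up and down by two different elements can be done in either order;
    what remains counts the elements outside of [s] and those inside. *)
Lemma down_up f s :
  down (up f) s + f s *+ #|s| = up (down f) s + f s *+ #|~: s|.
Proof.
have DU : down (up f) s = f s *+ #|~: s|
    + \sum_(i in ~: s) \sum_(m in s) f ((i |: s) :\ m).
  rewrite -sumr_const -big_split /=; apply: eq_bigr => i; rewrite inE => i's.
  by rewrite /up big_setU1 //= setU1K.
have UD : up (down f) s = f s *+ #|s|
    + \sum_(m in s) \sum_(i in ~: s) f ((i |: s) :\ m).
  rewrite -sumr_const -big_split /=; apply: eq_bigr => m ms.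
  rewrite /down (bigD1 m) ?inE ?eqxx //= setD1K //; congr (_ + _).
  apply: eq_big => [i | i /andP[_ im]].
    by rewrite !inE negb_and negbK; have [-> | _] := eqVneq i m;
       rewrite ?ms ?andbT.
  congr f; apply/setP => x; rewrite !inE.
  by have [-> | //] := eqVneq x i; rewrite im.
by rewrite DU UD exchange_big /= addrAC [RHS]addrAC [_ *+ _ + _ *+ _]addrC.
Qed.

(** For [f] on level [j], pairing the commutation relation with [f] gives
    [|up f|^2 = |down f|^2 + (#|T| - 2 j) |f|^2]. *)
Lemma up_inj j f :
    (2 * j < #|T|)%N ->
    (forall t, #|t| = j.+1 -> up f t = 0) ->
  forall s, #|s| = j -> f s = 0.
Proof.
move=> lt_jT upf0 s0 s0j.
pose h s := if #|s| == j then f s else 0.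
have uph0 t : up h t = 0.
  have [tj | tj] := eqVneq #|t| j.+1.
    rewrite -(upf0 t tj); apply: eq_bigr => i it.
    by rewrite /h; move/eqP: tj; rewrite (cardsD1 i) it add1n eqSS => ->.
  rewrite /up big1 // => i it; rewrite /h ifN //; apply: contra tj => /eqP <-.
  by rewrite (cardsD1 i t) it.
have hDU s : h s * down (up h) s =
    h s * up (down h) s + h s ^+ 2 *+ (#|T| - 2 * j).
  have [sj | sj] := eqVneq #|s| j; last first.
    by rewrite /h (negPf sj) expr0n mul0rn !mul0r addr0.
  apply: (addIr (h s * (h s *+ #|s|))).
  rewrite -mulrDr down_up mulrDr -addrA !mulrnAr -expr2 -mulrnDr.
  congr (_ + (_ *+ _)); have := cardsC s; rewrite sj; lia.
have sum0 : \sum_s (down h s ^+ 2 + h s ^+ 2 *+ (#|T| - 2 * j)) = 0.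
  have up_down : \sum_s h s * up (down h) s = \sum_s down h s ^+ 2.
    by rewrite [RHS]up_adjoint; apply: eq_bigr => s _; apply: mulrC.
  rewrite big_split -up_down -big_split /=.
  under eq_bigr => s _ do rewrite -hDU.
  by rewrite up_adjoint big1 // => t _; rewrite uph0 mul0r.
have ge0 s : true -> 0 <= down h s ^+ 2 + h s ^+ 2 *+ (#|T| - 2 * j).
  by move=> _; rewrite addr_ge0 ?mulrn_wge0 ?sqr_ge0.
have /eqP := psumr_eq0P ge0 sum0 (i := s0) isT.
rewrite paddr_eq0 ?mulrn_wge0 ?sqr_ge0 // => /andP[_].
by rewrite mulrn_eq0 subn_eq0 leqNgt lt_jT sqrf_eq0 /h s0j eqxx => /eqP.
Qed.

End BooleanLattice.

(** * Shattering *)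

(** Write [G Y S] for the sum of [g] over the members with trace [Y] on [S].
    Once all the sums on smaller sets vanish, [G Y S + G (i |: Y) S], which is a
    sum on [S :\ i], vanishes, so the [G Y S] agree up to sign as [Y] varies: a
    single zero forces them all to vanish.  On the full set, they are the values
    of [g].  The zero can come from a trace that does not occur, or from
    orthogonality to the monomial [x_S], which is the case [Y = S]. *)
Lemma trace_sums_eq0 {V : zmodType} {T : finType} {Fam : {set {set T}}}
    {g : {set T} -> V} :
    (forall S : {set T}, exists2 Y : {set T},
       Y \subset S & \sum_(F in Fam | F :&: S == Y) g F = 0) ->
  forall F, F \in Fam -> g F = 0.
Proof.
move=> zero_trace.
pose G (Y S : {set T}) := \sum_(F in Fam | F :&: S == Y) g F.
suff G0 m (S Y : {set T}) : #|S| = m -> Y \subset S -> G Y S = 0.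
  move=> F FFam; rewrite -(G0 _ setT F erefl (subsetT F)) /G.
  rewrite (big_pred1 F) // => E; rewrite setIT.
  by rewrite /=; case: eqVneq => [-> | _]; rewrite ?andbF ?FFam.
elim/ltn_ind: m S Y => m IHm S Y Sm sYS.
have Gsplit i (Z : {set T}) : i \in S -> i \notin Z -> Z \subset S ->
    G Z S = - G (i |: Z) S.
  move=> iS i'Z sZS; apply/eqP; rewrite -addr_eq0 addrC; apply/eqP.
  have sZSi : Z \subset S :\ i by rewrite subsetD1 sZS.
  have ltSi : (#|S :\ i| < m)%N by rewrite -Sm (cardsD1 i S) iS.
  rewrite -[RHS](IHm _ ltSi _ _ erefl sZSi).
  rewrite /G [RHS](bigID (fun F : {set T} => i \in F)) /=.
  have iFS (F : {set T}) : (i \in F) = (i \in F :&: S) by rewrite inE iS andbT.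
  congr (_ + _); apply: eq_bigl => F; rewrite -andbA setIDA iFS; congr (_ && _).
    apply/eqP/andP => [-> | [/eqP <- iF]]; last by rewrite setD1K.
    by rewrite setU1K // setU11.
  apply/eqP/andP => [-> | [/eqP <- iF]]; first rewrite i'Z.
    by split=> //; apply/eqP/setDidPl; rewrite disjoint_sym disjoints1.
  by apply/esym/setDidPl; rewrite disjoint_sym disjoints1.
have Gtop n (Z : {set T}) : #|S :\: Z| = n -> Z \subset S ->
    (G Z S == 0) = (G S S == 0).
  elim: n Z => [|n IHn] Z SZn sZS.
    suff -> : Z = S by [].
    by apply/eqP; rewrite eqEsubset sZS -setD_eq0 -cards_eq0 SZn.
  have /card_gt0P[i] : (0 < #|S :\: Z|)%N by rewrite SZn.
  rewrite inE => /andP[i'Z iS]; rewrite (Gsplit i) // oppr_eq0 IHn //.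
    move/eqP: SZn; rewrite (cardsD1 i) inE iS i'Z add1n eqSS => /eqP <-.
    by rewrite setDDl setUC.
  by rewrite subUset sub1set iS.
have [Z sZS /eqP] := zero_trace S; rewrite -/(G Z S).
by rewrite (Gtop _ _ erefl sZS) -(Gtop _ _ erefl sYS) => /eqP.
Qed.

Lemma not_shattersP {T : finType} {Fam : {set {set T}}} {S : {set T}} :
    ~ shatters Fam S ->
  exists2 Y : {set T}, Y \subset S & forall F, F \in Fam -> F :&: S != Y.
Proof.
move=> nsh.
have [/forallP sh | /forallPn[Y]] :=
    boolP [forall Y : {set T},
             (Y \subset S) ==> [exists F in Fam, F :&: S == Y]].
  case: nsh => Y sYS; have /implyP/(_ sYS)/exists_inP[F FFam /eqP] := sh Y.
  by exists F.
rewrite negb_imply => /andP[sYS /exists_inPn noF].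
by exists Y.
Qed.

(** * Multiplication by an affine form *)

(** The coefficient of [x_t] in the product of [\sum_i w_i x_i - k] and [x_s],
    in the ring where [x_i ^+ 2 = x_i]. *)
Definition affine_coef {R : nzRingType} {T : finType} (w : T -> R) (k : R)
    (s t : {set T}) : R :=
  \sum_i w i * (t == i |: s)%:R - k * (t == s)%:R.

(** In a product, the coefficients of top degree involve only the leading form
    of the factor [c], rescaled by the weights to a function killed by [up].
    Hence the homogeneous parts of [c] vanish, by descending degree. *)
Lemma mul_affine_inj {R : realFieldType} {T : finType} {w : T -> R} {k : R}
    {d : nat} {c : {set T} -> R} :
    (forall i, w i != 0) -> (2 * d <= #|T|.+1)%N ->
    (forall t : {set T}, (#|t| <= d)%N ->
       \sum_(s : {set T} | (#|s| < d)%N) c s * affine_coef w k s t = 0) ->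
  forall s : {set T}, (#|s| < d)%N -> c s = 0.
Proof.
move=> w_neq0 le_dT cf0.
suff c0 m (s : {set T}) : (#|s| < d)%N -> (d <= #|s| + m)%N -> c s = 0.
  by move=> s sd; apply: (c0 d) => //; rewrite leq_addl.
elim: m s => [|m IHm] s sd dsm.
  by move: sd; rewrite ltnNge -[#|s|]addn0 dsm.
pose W (s : {set T}) := \prod_(i in s) w i.
have W_neq0 (t : {set T}) : W t != 0 by apply/prodf_neq0.
suff: c s / W s = 0.
  by move/eqP; rewrite mulf_eq0 invr_eq0 (negPf (W_neq0 s)) orbF => /eqP.
apply: (up_inj _ _ #|s| (fun s => c s / W s)) => //; first by lia.
move=> t ts; apply: (mulfI (W_neq0 t)); rewrite mulr0.
(* The terms of [c] of the same degree as [t] have been shown to vanish. *)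
have c0 (r : {set T}) : (#|r| < d)%N -> #|r| = #|t| -> c r = 0.
  by move=> rd rt; apply: IHm => //; lia.
have td : (#|t| <= d)%N by rewrite ts.
rewrite -(cf0 t td) /up mulr_sumr.
under [RHS]eq_bigr => r _ do rewrite /affine_coef mulrBr mulr_sumr.
rewrite sumrB [X in _ = _ - X]big1 ?subr0; last first.
  move=> r rd; have [tr | _] := eqVneq t r; last by rewrite !mulr0.
  by rewrite c0 ?tr // mul0r.
rewrite exchange_big /= [RHS](bigID (fun i => i \in t)) /=.
rewrite [X in _ = _ + X]big1 ?addr0.
  apply: eq_bigr => i it.
  have ti : #|t :\ i| = #|s|.
    by apply/eqP; move/eqP: ts; rewrite (cardsD1 i) it add1n eqSS.
  rewrite (bigD1 (t :\ i)) ?ti //= setD1K // eqxx mulr1 big1 ?addr0.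
    have -> : W t = w i * W (t :\ i) by apply: big_setD1.
    by rewrite mulrACA divff // mulr1 mulrC.
  move=> r /andP[rd rti].
  have [tr | _] := eqVneq t (i |: r); last by rewrite !mulr0.
  (* If [i] is in [r], then [r = t] has the degree of [t]; if not, then
     [r = t :\ i]. *)
  have [ir | i'r] := boolP (i \in r).
    by rewrite c0 ?mul0r // tr (setUidPr _) ?sub1set.
  by rewrite tr setU1K ?eqxx in rti.
move=> i i't; apply: big1 => r _.
by rewrite [t == _]negbTE ?mulr0 //; apply: contra i't => /eqP->; apply: setU11.
Qed.

(** * Level sets of linear forms *)

Theorem card_level_set_le {R : realFieldType} {T : finType} {w : T -> R} {k : R}
    {Fam : {set {set T}}} {d : nat} :
    (forall i, w i != 0) ->
    (forall F, F \in Fam -> \sum_(i in F) w i = k) ->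
    (2 * d <= #|T|.+1)%N ->
    (forall L : {set T}, #|L| = d.+1 -> ~ shatters Fam L) ->
  (#|Fam| <= 'C(#|T|, d))%N.
Proof.
move=> w_neq0 sum_w le_dT nsh.
pose A := [set s : {set T} | (#|s| < d)%N].
pose B := [set t : {set T} | (#|t| <= d)%N].
have cardB : #|B| = (#|A| + 'C(#|T|, d))%N.
  rewrite -card_draws -(cardsID A B); congr (_ + _)%N; apply: eq_card => s.
    by rewrite !inE andb_idl // => /ltnW.
  by rewrite !inE -leqNgt eqn_leq andbC.
rewrite -(leq_add2l #|A|) -cardB.
pose M (t F : {set T}) : R := (t \subset F)%:R.
apply: (card_exact_le _ _ _ _ A B Fam (affine_coef w k) M).
- move=> c cf0 s; rewrite inE; apply: mul_affine_inj => //.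
  move=> t td; rewrite -[RHS](cf0 t) ?inE //; apply: eq_bigl => r.
  by rewrite inE.
- move=> g gM0; apply: trace_sums_eq0 => S.
  have [Sd | dS] := leqP #|S| d.
    exists S => //; rewrite -[RHS](gM0 S) ?inE // big_mkcondr.
    apply: eq_bigr => F _.
    by rewrite /M (sameP eqP setIidPr); case: ifP => _; rewrite ?mul1r ?mul0r.
  have [/= e [ue se /subsetP sub_eS]] := card_geqP dS.
  have [|Y sYL noF] := not_shattersP (nsh [set:: e] _).
    by rewrite cardsE (card_uniqP ue).
  have sLS : [set:: e] \subset S.
    by apply/subsetP => x; rewrite inE => /(subsetP sub_eS).
  exists Y; first exact: subset_trans sYL sLS.
  rewrite big1 // => F /andP[FFam /eqP FSY]; have /eqP[] := noF F FFam.
  by rewrite -(setIidPr sLS) setIA FSY; apply/setIidPl.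
move=> s F; rewrite inE => sd FFam.
have pick (r : {set T}) : (#|r| <= d)%N ->
    \sum_(t in B) (t == r)%:R * M t F = M r F.
  move=> rd; rewrite (bigD1 r) ?inE //= eqxx mul1r big1 ?addr0 // => t.
  by case/andP=> _ /negPf->; rewrite mul0r.
transitivity (\sum_i w i * M (i |: s) F - k * M s F).
  under eq_bigr => t _ do rewrite mulrBl mulr_suml.
  rewrite sumrB exchange_big /=; congr (_ - _).
    apply: eq_bigr => i _; rewrite -pick; last first.
      by rewrite cardsU1 (leq_trans _ sd) // -add1n leq_add2r leq_b1.
    by rewrite mulr_sumr; apply: eq_bigr => t _; rewrite mulrA.
  rewrite -pick; last exact: ltnW.
  by rewrite mulr_sumr; apply: eq_bigr => t _; rewrite mulrA.
rewrite /M -(sum_w F FFam) mulr_suml [X in _ - X]big_mkcond -sumrB.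
rewrite big1 // => i _ /=; rewrite subUset sub1set.
by case: (i \in F); rewrite /= ?mulr0 ?mul0r ?subrr.
Qed.

Theorem corollary1p3 (n : nat) (n_gt0 : (0 < n)%N)
    (a : 'rV[int]_n) (a_gt0 : forall i : 'I_n, 0 < a 0 i)
    (k l : nat) (l_le : (2 * l <= n)%N)
    (not_shattered : forall L : {set 'I_n}, #|L| = l ->
       ~ shatters (family_of_vectors (subset_sum_vectors a k)) L) :
  (#|subset_sum_vectors a k| <= binomial_int n (l%:Z - 1))%N.
Proof.
set Fam := family_of_vectors _ in not_shattered.
have charK :
    cancel (fun v : {ffun 'I_n -> bool} => [set i | v i]) (@char_vector n).
  by move=> v; apply/ffunP => i; rewrite ffunE inE.
have cardFam : #|subset_sum_vectors a k| = #|Fam|.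
  rewrite -(card_imset _ (can_inj charK)); apply: eq_card => F; rewrite inE.
  apply/imsetP/idP => [[v vS ->] | FS]; first by rewrite charK.
  by exists (char_vector F) => //; apply/setP => i; rewrite inE ffunE.
rewrite cardFam; case: l l_le not_shattered => [|d] le_dn nsh.
  (* Every nonempty family shatters the empty set. *)
  rewrite leqn0 cards_eq0; apply/eqP/setP => F; rewrite [RHS]inE.
  apply/negP => FFam.
  apply: (nsh set0 (cards0 _)) => Y; rewrite subset0 => /eqP ->.
  by exists F; rewrite ?setI0.
have -> : d.+1%:Z - 1 = d by rewrite -addn1 PoszD addrK.
have := @card_level_set_le rat _ (fun i => (a 0 i)%:~R) k%:R Fam d.
rewrite card_ord; apply=> //; last by lia.
  by move=> i; rewrite intr_eq0 gt_eqF.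
move=> F; rewrite !inE => /eqP sum_a.
rewrite pmulrn -sum_a rmorph_sum big_mkcond /=; apply: eq_bigr => i _.
by rewrite ffunE; case: ifP; rewrite ?mulr1 ?mulr0.
Qed.
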